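(* Let $K,L\ge 0$ be integers, $n=K+L+1$, and $\mu=(K+1,1^L)$. Let $X_n=(x_1,\dots,x_n)$ and $Y_n=(y_1,\dots,y_n)$. Then the annihilator ideal $I_\mu$ of $\Delta_\mu$ is the ideal of $\mathbb Q[x_1,\dots,x_n,y_1,\dots,y_n]$ generated by the following polynomials: $h_i(X_n)$ for $1\le i\le n$; $h_i(Y_n)$ for $1\le i\le n$; $x_iy_i$ for $1\le i\le n$; $\prod_{x\in X}x$ for all $X\subseteq\{x_1,\dots,x_n\}$ with $|X|=L+1$; and $\prod_{y\in Y}y$ for all $Y\subseteq\{y_1,\dots,y_n\}$ with $|Y|=K+1$.
   Context: The set of biexponents of the hook $\mu=(K+1,1^L)$ is $\{(0,0),(0,1),\dots,(0,K),(1,0),\dots,(L,0)\}$; list it in lexicographic order as $(p_1,q_1),\dots,(p_n,q_n)$ and set $\Delta_\mu=\det(x_i^{p_j}y_i^{q_j})_{1\le i,j\le n}$. For a polynomial $P$ in $x_1,\dots,x_n,y_1,\dots,y_n$, $P(\partial)$ is the differential operator obtained by substituting $x_i\mapsto\partial_{x_i}$, $y_i\mapsto\partial_{y_i}$, and $I_\mu=\{P: P(\partial)\Delta_\mu=0\}$. $h_k$ denotes the complete homogeneous symmetric polynomial of degree $k$. *)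

(* Defs.v *)
From HB Require Import structures.
From mathcomp Require Export all_boot all_order all_algebra.
From mathcomp Require Export mpoly.

Set Implicit Arguments.
Unset Strict Implicit.
Unset Printing Implicit Defensive.

Import GRing.Theory.

Local Open Scope ring_scope.

(* The first n of the n + n variables are x_1, ..., x_n, the last n are
   y_1, ..., y_n; indices start at 0. *)
Definition xvar (n : nat) (i : 'I_n) : {mpoly rat[n + n]} := 'X_(lshift n i).
Definition yvar (n : nat) (i : 'I_n) : {mpoly rat[n + n]} := 'X_(rshift n i).

Definition hook_biexponents (K L : nat) : seq (nat * nat) :=
  [seq (0%N, q) | q <- iota 0 K.+1] ++ [seq (p, 0%N) | p <- iota 1 L].

Definition lex_lt (a b : nat * nat) : bool :=
  (a.1 < b.1)%N || ((a.1 == b.1) && (a.2 < b.2)%N).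

Lemma size_hook_biexponents (K L : nat) :
  size (hook_biexponents K L) = (K + L + 1)%N.
Proof. by rewrite size_cat !size_map !size_iota addn1. Qed.

Lemma sorted_hook_biexponents (K L : nat) :
  sorted lex_lt (hook_biexponents K L).
Proof.
have lexT : transitive lex_lt.
  move=> [b1 b2] [a1 a2] [c1 c2]; rewrite /lex_lt /=.
  case/orP=> [ab|/andP[/eqP-> ab]]; case/orP=> [bc|/andP[/eqP<- bc]].
  - by rewrite (ltn_trans ab bc).
  - by rewrite ab.
  - by rewrite bc.
  - by rewrite eqxx (ltn_trans ab bc) orbT.
rewrite sorted_pairwise // /hook_biexponents pairwise_cat -!sorted_pairwise //.
apply/and3P; split.
- apply/allrelP=> a b /mapP[q _ ->] /mapP[p + ->].
  by rewrite mem_iota /lex_lt /= => /andP[-> _].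
- rewrite sorted_map; apply: sub_sorted (iota_ltn_sorted 0 K.+1) => i j /= ij.
  by apply/orP; right; apply/andP; split.
- rewrite sorted_map; apply: sub_sorted (iota_ltn_sorted 1 L) => i j /= ij.
  by apply/orP; left.
Qed.

(* Intended for size s = n, so that the default value of nth is not used. *)
Definition Delta (n : nat) (s : seq (nat * nat)) : {mpoly rat[n + n]} :=
  \det (\matrix_(i < n, j < n)
          (xvar i ^+ (nth (0%N, 0%N) s j).1 * yvar i ^+ (nth (0%N, 0%N) s j).2)).

(* P(d) Q; mderivm m is the iterated partial derivative
   prod_i (d/dX_i) ^ (m i). *)
Definition diff_op (N : nat) (P Q : {mpoly rat[N]}) : {mpoly rat[N]} :=
  \sum_(m <- msupp P) P@_m *: mderivm m Q.

Definition annihilator (N : nat) (Q : {mpoly rat[N]}) : {mpoly rat[N]} -> Prop :=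
  fun P => diff_op P Q = 0.

Definition complete_hom (n : nat) (R : comNzRingType) (k : nat) (z : 'I_n -> R)
    : R :=
  \sum_(m : 'X_{1..n < k.+1} | mdeg m == k) \prod_(i < n) z i ^+ m i.

Definition ideal_generated (R : comNzRingType) (G : R -> Prop) : R -> Prop :=
  fun P => exists s : seq (R * R),
    (forall u, u \in s -> G u.2) /\ P = \sum_(u <- s) u.1 * u.2.

Inductive hook_generator (K L n : nat) : {mpoly rat[n + n]} -> Prop :=
| gen_hx (i : nat) of (1 <= i <= n)%N :
    hook_generator K L (complete_hom i (@xvar n))
| gen_hy (i : nat) of (1 <= i <= n)%N :
    hook_generator K L (complete_hom i (@yvar n))
| gen_xy (i : 'I_n) : hook_generator K L (xvar i * yvar i)
| gen_prodx (A : {set 'I_n}) of #|A| = L.+1 :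
    hook_generator K L (\prod_(i in A) xvar i)
| gen_prody (A : {set 'I_n}) of #|A| = K.+1 :
    hook_generator K L (\prod_(i in A) yvar i).

(* Main.v *)
Require Import Defs.
From mathcomp Require Import fingroup perm zify ring.

(* The ring Q[X, Y] / (x_i y_i, products of L + 1 x's, products of K + 1 y's) is
   the Stanley-Reisner ring of a Bier sphere, whose facets are the words with L
   letters x, K letters y and one hole.  Ordered lexicographically with
   x < hole < y, the facets form a shelling: the restriction of a facet is the
   set of the x's to the right of its hole and of the y's to the left of it.
   Modulo the h_i, the piece of the shelling belonging to a facet F becomes the
   restriction monomial of F times the coinvariant rings of the x's and of the
   y's of F, which are spanned by monomials with staircase exponents.  These
   normal monomials are independent modulo the annihilator: pairing a normal
   monomial with its complement to the largest monomial on F extracts a single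
   coefficient +-1 of Delta, and the other pairings vanish unless the facet, or
   for equal facets a weight of the monomial, is smaller. *)

Set Implicit Arguments.
Unset Strict Implicit.
Unset Printing Implicit Defensive.

Import GRing.Theory.

Local Open Scope ring_scope.

(** * Monomials in two alphabets; the Boolean [true] stands for x and [false] for y *)

Definition vidx (n : nat) (c : bool) (i : 'I_n) : 'I_(n + n) :=
  if c then lshift n i else rshift n i.

Definition zvar (n : nat) (c : bool) (i : 'I_n) : {mpoly rat[n + n]} :=
  'X_(vidx c i).

Lemma eq_vidx n c d (i j : 'I_n) :
  (vidx c i == vidx d j) = (c == d) && (i == j).
Proof.
by case: c d => [] [] /=;
  rewrite /vidx ?eq_shift ?andbF.
Qed.

Lemma vidx_mnmP n (m m' : 'X_{1..n + n}) :
  (forall c i, m (vidx c i) = m' (vidx c i)) -> m = m'.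
Proof.
move=> mm'; apply/mnmP => k; rewrite -(splitK k).
by case: (split k) => i; [apply: (mm' true) | apply: (mm' false)].
Qed.

Lemma big_vidx (R : Type) (idx : R) (op : Monoid.com_law idx) n
    (F : 'I_(n + n) -> R) :
  \big[op/idx]_k F k = \big[op/idx]_c \big[op/idx]_(i < n) F (vidx c i).
Proof. by rewrite big_split_ord big_bool. Qed.

Definition vmnm n (f : bool -> 'I_n -> nat) : 'X_{1..n + n} :=
  [multinom match split k with inl i => f true i | inr i => f false i end
  | k < n + n].

Lemma vmnmE n (f : bool -> 'I_n -> nat) c i : vmnm f (vidx c i) = f c i.
Proof.
rewrite mnmE; case: c; first by rewrite (unsplitK (inl _)).
by rewrite (unsplitK (inr _)).
Qed.

Lemma mpolyX_vmnm n (f : bool -> 'I_n -> nat) :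
  'X_[vmnm f] = \prod_c \prod_i zvar c i ^+ f c i.
Proof.
rewrite mpolyXE_id big_vidx; apply: eq_bigr => c _; apply: eq_bigr => i _.
by rewrite vmnmE.
Qed.

Definition cell n (m : 'X_{1..n + n}) (i : 'I_n) : nat * nat :=
  (m (vidx true i), m (vidx false i)).

Definition coord (c : bool) (a : nat * nat) : nat := if c then a.1 else a.2.

Lemma coord_cell n (m : 'X_{1..n + n}) c i : coord c (cell m i) = m (vidx c i).
Proof. by case: c. Qed.

(** A permutation contributes to Delta the single monomial whose i-th cell is the biexponent chosen
    in row i. Keeping the permutations that match every cell of [m] leaves a determinant of zeros
    and ones. *)
Lemma mcoeff_Delta n (s : seq (nat * nat)) (m : 'X_{1..n + n}) :
  (Delta n s)@_m =
  \det (\matrix_(i < n, j < n) (cell m i == nth (0, 0)%N s j)%:R).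
Proof.
rewrite /Delta /determinant raddf_sum /=; apply: eq_bigr => sg _.
pose f (c : bool) i := coord c (nth (0, 0)%N s (sg i)).
rewrite (_ : \prod_i _ = 'X_[vmnm f] :> {mpoly rat[n + n]}); last first.
  rewrite mpolyX_vmnm big_bool -big_split.
  by apply: eq_bigr => i _; rewrite mxE.
rewrite (_ : \prod_i _ = (vmnm f == m)%:R); last first.
  under eq_bigr do rewrite mxE.
  case: eqP => [<-|ne].
    apply: big1 => i _; rewrite (_ : _ == _) //.
    by apply/eqP; rewrite /cell !vmnmE -surjective_pairing.
  case: (pickP (fun i => cell m i != nth (0, 0)%N s (sg i))) => [i ni|all].
    by rewrite (bigD1 i) //= (negbTE ni) mul0r.
  case: ne; apply: vidx_mnmP => c i; rewrite vmnmE /f.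
  by move/negbFE/eqP: (all i) => <-; rewrite coord_cell.
by rewrite !mulr_sign; case: (odd_perm sg); rewrite ?mcoeffN mcoeffX.
Qed.

(** * Complete homogeneous polynomials through generating functions *)

Lemma coef_prod_sumX (R : comNzRingType) (n B : nat) (a : 'I_n -> 'I_B -> R) d :
  (\prod_i \sum_k a i k *: 'X^k)`_d =
  \sum_(f : {ffun 'I_n -> 'I_B} | (\sum_i f i)%N == d) \prod_i a i (f i).
Proof.
rewrite bigA_distr_bigA coef_sum [RHS]big_mkcond; apply: eq_bigr => f _.
rewrite scaler_prod prodrXr coefZ coefXn eq_sym.
by case: eqP; rewrite ?mulr1 ?mulr0.
Qed.

(** The bound [B] is independent of [d], so that several degrees can be read off one product of
    truncated geometric series. *)
Lemma complete_hom_ffun (R : comNzRingType) (n B d : nat) (z : 'I_n -> R) :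
  (d <= B)%N -> complete_hom d z =
  \sum_(f : {ffun 'I_n -> 'I_B.+1} | (\sum_i f i)%N == d) \prod_i z i ^+ f i.
Proof.
move=> dB; rewrite /complete_hom.
pose h (f : {ffun 'I_n -> 'I_B.+1}) : 'X_{1..n < d.+1} :=
  insubd bm0 [multinom nat_of_ord (f i) | i < n].
pose h' (m : 'X_{1..n < d.+1}) : {ffun 'I_n -> 'I_B.+1} :=
  [ffun i => inord (m i)].
have h'E m i : h' m i = m i :> nat.
  rewrite ffunE inordK //; have := bmdeg m; rewrite mdegE (bigD1 i) //=; lia.
have hE (f : {ffun 'I_n -> 'I_B.+1}) :
    (\sum_i f i)%N = d -> forall i, h f i = f i :> nat.
  move=> fd i; rewrite /h insubdK ?mnmE // -topredE /= mdegE.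
  by under eq_bigr do rewrite mnmE; rewrite fd.
rewrite (reindex_onto h h') => [|m /eqP md]; last first.
  apply: val_inj; apply/mnmP => i; rewrite /= hE ?h'E //.
  by rewrite -md mdegE; apply: eq_bigr => j _; rewrite h'E.
have condE f : (mdeg (h f) == d) && (h' (h f) == f) = ((\sum_i f i)%N == d).
  apply/andP/eqP => [[/eqP <- /eqP ff]|fd].
    by rewrite mdegE -{1}ff; apply: eq_bigr => i _; rewrite h'E.
  split; first by rewrite mdegE (eq_bigr _ (fun i _ => hE f fd i)) fd.
  by apply/eqP/ffunP => i; apply: val_inj; rewrite /= h'E hE.
apply: eq_big => // f; rewrite condE => /eqP fd.
by apply: eq_bigr => i _; rewrite hE.
Qed.

Lemma complete_hom_rec (R : comNzRingType) (n d : nat) (z w : 'I_n -> R) a :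
  w a = 0 -> (forall i, i != a -> w i = z i) ->
  complete_hom d.+1 z = complete_hom d.+1 w + z a * complete_hom d z.
Proof.
move=> wa wz; pose S (y : 'I_n -> R) i : {poly R} :=
  \sum_(k < d.+2) (y i ^+ k) *: 'X^k.
have homE y e : (e <= d.+1)%N -> complete_hom e y = (\prod_i S y i)`_e.
  by move=> le; rewrite (complete_hom_ffun y le) coef_prod_sumX.
rewrite !homE // (bigD1 a) //= [in X in _ = X`__ + _](bigD1 a) //=.
have -> : \prod_(i < n | i != a) S w i = \prod_(i < n | i != a) S z i.
  by apply: eq_bigr => i ia; rewrite /S wz.
move: (\prod_(i < n | i != a) S z i) => Q.
have -> : S w a = 1.
  rewrite /S big_ord_recl big1 => [|i _]; first by rewrite addr0 !expr0 scale1r.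
  by rewrite wa expr0n scale0r.
(* The geometric series satisfies [S = 1 + z X S]; truncation costs a term of degree [d + 2], which
   does not reach the coefficient [d + 1]. *)
have SE : S z a = 1 + (z a *: 'X) * S z a - (z a *: 'X) ^+ d.+2.
  have -> : S z a = \sum_(k < d.+2) (z a *: 'X) ^+ k.
    by apply: eq_bigr => k _; rewrite exprZn.
  have := subrX1 (z a *: 'X : {poly R}) d.+2.
  move: (\sum_(k < d.+2) _) => T; set y := _ ^+ _ => H.
  have -> : y = 1 + (y - 1) by ring.
  by rewrite H; ring.
have SQ : S z a * Q =
    Q + (z a *: (S z a * Q)) * 'X - (z a ^+ d.+2 *: Q) * 'X^(d.+2).
  by rewrite {1}SE exprZn -!mul_polyC; ring.
by rewrite {1}SQ coefB coefD coefMX coefMXn ltnSn subr0 coefZ mul1r.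
Qed.

(** * Closure properties of generated ideals, and ternary numbers *)

Lemma ideal_generated_gen (R : comNzRingType) (G : R -> Prop) g :
  G g -> ideal_generated G g.
Proof.
move=> Gg; exists [:: (1, g)]; split; last by rewrite big_seq1 mul1r.
by move=> u; rewrite inE => /eqP ->.
Qed.

Lemma ideal_generatedD (R : comNzRingType) (G : R -> Prop) P Q :
  ideal_generated G P -> ideal_generated G Q -> ideal_generated G (P + Q).
Proof.
move=> [s [sG ->]] [t [tG ->]]; exists (s ++ t); split; last by rewrite big_cat.
by move=> u; rewrite mem_cat => /orP[/sG|/tG].
Qed.

Lemma ideal_generatedM (R : comNzRingType) (G : R -> Prop) P Q :
  ideal_generated G P -> ideal_generated G (Q * P).
Proof.
move=> [s [sG ->]]; exists [seq (Q * u.1, u.2) | u <- s]; split.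
  by move=> u /mapP[v /sG Gv ->].
by rewrite big_map mulr_sumr; apply: eq_bigr => u _; rewrite mulrA.
Qed.

Lemma ideal_generated0 (R : comNzRingType) (G : R -> Prop) :
  ideal_generated G 0.
Proof. by exists [::]; rewrite big_nil. Qed.

(** The digit [a 0] is the most significant, so these numbers order ternary words
    lexicographically. *)
Fixpoint base3 (a : nat -> nat) (m : nat) : nat :=
  if m is k.+1 then (3 * base3 a k + a k)%N else 0%N.

Lemma base3_lt a b p m : (forall j, j < p -> a j = b j)%N -> (a p < b p)%N ->
  (forall j, a j < 3)%N -> (p < m)%N -> (base3 a m < base3 b m)%N.
Proof.
move=> eq_ab lt_ab a3; elim: m => // m IH; rewrite ltnS leq_eqVlt /=.
case/orP=> [/eqP pm|/IH]; last by have := a3 m; lia.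
suff -> : base3 a m = base3 b m by rewrite -pm ltn_add2l.
rewrite -pm; elim: {m IH pm} p eq_ab {lt_ab} => //= p IH eq_ab.
by rewrite eq_ab // IH // => j jp; apply: eq_ab; apply: ltnW.
Qed.

(** * The coefficients of Delta and the pairing with Delta *)

Section HookDelta.

Variables (K L n : nat).
Hypothesis hn : n = (K + L + 1)%N.

Local Notation hook := (hook_biexponents K L).
Local Notation D := (Delta n hook).

Lemma size_hook : size hook = n.
Proof. by rewrite size_hook_biexponents hn. Qed.

Lemma mem_hook p q :
  ((p, q) \in hook) = (p == 0)%N && (q <= K)%N || (q == 0)%N && (p <= L)%N.
Proof.
rewrite mem_cat; apply/orP/orP => [[] /mapP[k] | [] /andP[/eqP-> le]].
- by rewrite mem_iota => le [-> ->]; left; lia.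
- by rewrite mem_iota => le [-> ->]; right; lia.
- by left; apply/mapP; exists q => //; rewrite mem_iota; lia.
case: p le => [|p] le; last first.
  by right; apply/mapP; exists p.+1 => //; rewrite mem_iota; lia.
by left; apply/mapP; exists 0%N => //; rewrite mem_iota; lia.
Qed.

Lemma lex_lt_trans : transitive lex_lt.
Proof. by move=> [b1 b2] [a1 a2] [c1 c2]; rewrite /lex_lt /=; lia. Qed.

Lemma uniq_hook : uniq hook.
Proof.
apply: (sorted_uniq lex_lt_trans _ (sorted_hook_biexponents K L)).
by move=> [a b]; rewrite /lex_lt /= !ltnn andbF.
Qed.

Lemma nth_hook_lt (i j : 'I_n) : (i < j)%N ->
  lex_lt (nth (0, 0)%N hook i) (nth (0, 0)%N hook j).
Proof.
move=> ij; apply: (sorted_ltn_nth lex_lt_trans) => //;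
  first exact: sorted_hook_biexponents; by rewrite inE size_hook ltn_ord.
Qed.

Definition cells_permute_hook (m : 'X_{1..n + n}) :=
  exists s : 'S_n, forall i, cell m i = nth (0, 0)%N hook (s i).

Lemma mcoeff_Delta_neq0 (m : 'X_{1..n + n}) :
  D@_m != 0 <-> cells_permute_hook m.
Proof.
rewrite mcoeff_Delta; split=> [nz | [s sE]]; last first.
  rewrite (_ : matrix_of_fun _ _ = perm_mx s).
    by rewrite det_perm signr_eq0.
  apply/matrixP => i j; rewrite !mxE sE (nth_uniq _ _ _ uniq_hook) //;
    by rewrite size_hook ltn_ord.
case: (pickP (fun s : 'S_n =>
    [forall i, cell m i == nth (0, 0)%N hook (s i)])) => [s /forallP sE|no].
  by exists s => i; apply/eqP.
case/eqP: nz; apply: big1 => s _.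
have /negbT/forallPn[i ni] := no s.
by rewrite (bigD1 i) //= mxE (negbTE ni) mul0r mulr0.
Qed.

Lemma cells_permute_hook_inj (m : 'X_{1..n + n}) :
  injective (cell m) -> (forall i, cell m i \in hook) -> cells_permute_hook m.
Proof.
move=> inj mem.
have lt i : (index (cell m i) hook < n)%N.
  by have := mem i; rewrite -index_mem size_hook.
have sinj : injective (fun i => Ordinal (lt i)).
  move=> i j [/(congr1 (nth (0, 0)%N hook))].
  by rewrite !nth_index // => /inj.
by exists (perm sinj) => i; rewrite permE /= nth_index.
Qed.

(** Every symmetric statistic of the cells takes the same value on all monomials of Delta; it is
    applied to support sizes, factorials and squares. *)
Lemma big_cells_hook (R : Type) (idx : R) (op : Monoid.com_law idx)
    (g : nat * nat -> R) m : cells_permute_hook m ->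
  \big[op/idx]_(i < n) g (cell m i) = \big[op/idx]_(a <- hook) g a.
Proof.
move=> [s sE]; rewrite (big_nth (0, 0)%N) size_hook big_mkord.
rewrite [RHS](reindex_inj (@perm_inj _ s)) /=.
by apply: eq_bigr => i _; rewrite sE.
Qed.

Lemma cells_permute_hook_mem m i : cells_permute_hook m -> cell m i \in hook.
Proof. by move=> [s ->]; rewrite mem_nth // size_hook ltn_ord. Qed.

Definition arm (c : bool) : nat := if c then L else K.

Lemma card_cells_supp c m : cells_permute_hook m ->
  #|[set i | (0 < m (vidx c i))%N]| = arm c.
Proof.
move=> mP; rewrite -sum1_card big_mkcond.
under eq_bigr do rewrite inE -coord_cell.
rewrite (big_cells_hook _ (fun a => if 0 < coord c a then 1 else 0))%N //.
rewrite -big_mkcond sum1_count count_cat !count_map.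
have -> k : iota 0 k.+1 = 0%N :: iota 1 k by [].
case: c => /=; rewrite ?add0n.
  rewrite (eq_count (a2 := pred0)) // count_pred0 add0n.
  rewrite (eq_in_count (a2 := predT)) ?count_predT ?size_iota // => k.
  by rewrite mem_iota /=; lia.
rewrite addnC (eq_count (a2 := pred0)) // count_pred0 add0n.
rewrite (eq_in_count (a2 := predT)) ?count_predT ?size_iota // => k.
by rewrite mem_iota /=; lia.
Qed.

(** Up to a constant product of factorials, this is the value of [P(d) Delta] at the origin. *)
Definition pairing (P : {mpoly rat[n + n]}) : rat :=
  \sum_(m <- msupp D) D@_m * P@_m.

Lemma pairing_sum I r (Q : pred I) (F : I -> {mpoly rat[n + n]}) :
  pairing (\sum_(i <- r | Q i) F i) = \sum_(i <- r | Q i) pairing (F i).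
Proof.
rewrite /pairing exchange_big; apply: eq_bigr => m _ /=.
by rewrite -mulr_sumr; congr (_ * _); apply: raddf_sum.
Qed.

Lemma pairingZ a P : pairing (a *: P) = a * pairing P.
Proof.
by rewrite /pairing mulr_sumr; apply: eq_bigr => m _; rewrite mcoeffZ mulrCA.
Qed.

Lemma pairingB P Q : pairing (P - Q) = pairing P - pairing Q.
Proof.
by rewrite /pairing -sumrB; apply: eq_bigr => m _; rewrite mcoeffB mulrBr.
Qed.

Lemma pairingX m : pairing 'X_[m] = D@_m.
Proof.
rewrite /pairing; under eq_bigr do rewrite mcoeffX.
case: (boolP (m \in msupp D)) => mD.
  rewrite (bigD1_seq m) ?msupp_uniq //= eqxx mulr1 big1 ?addr0 // => k.
  by rewrite eq_sym => /negbTE ->; rewrite mulr0.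
rewrite big_seq big1 => [|k kD]; first by rewrite memN_msupp_eq0.
by case: eqP => [mk|_]; [rewrite mk kD in mD | rewrite mulr0].
Qed.

Lemma pairingMX P u :
  pairing (P * 'X_[u]) = \sum_(m <- msupp P) P@_m * D@_(m + u).
Proof.
rewrite {1}[P]mpolyE mulr_suml pairing_sum; apply: eq_bigr => m _.
by rewrite -scalerAl pairingZ -mpolyXD pairingX.
Qed.

Lemma prod_fact_cells m : cells_permute_hook m ->
  (\prod_k (m k)`! = \prod_(a <- hook) (a.1`! * a.2`!))%N.
Proof.
move=> mP; rewrite (big_vidx muln) big_bool -big_split /=.
exact: (big_cells_hook muln (fun a => a.1`! * a.2`!)%N mP).
Qed.

(* All monomials of Delta have the same product of factorials, so
   differentiation can be traded for contraction of monomials. *)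
Lemma mcoeff_diff_op (P : {mpoly rat[n + n]}) (u : 'X_{1..n + n}) :
  (\prod_k (u k)`!)%:R * (diff_op P D)@_u =
  (\prod_(a <- hook) (a.1`! * a.2`!))%N%:R * pairing (P * 'X_[u]).
Proof.
rewrite pairingMX /diff_op [X in _ * X = _]raddf_sum /=.
rewrite mulr_sumr mulr_sumr; apply: eq_bigr => m _ /=.
rewrite mcoeffZ mcoeff_mderivm.
case: (eqVneq (D@_(m + u)) 0) => [->|/mcoeff_Delta_neq0 mP].
  by rewrite mul0rn !mulr0.
rewrite -(prod_fact_cells mP) -mulr_natr.
suff -> : (\prod_k ((m + u)%MM k)`! =
    (\prod_k (u k)`!) * \prod_k ((m + u)%MM k) ^_ (m k))%N.
  by rewrite natrM; ring.
rewrite -big_split; apply: eq_bigr => k _ /=.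
by rewrite mnmDE mulnC -(ffact_fact (leq_addr _ _)) addKn.
Qed.

(** The factorial products in [mcoeff_diff_op] are nonzero in [rat], so each coefficient of
    [P(d) Delta] vanishes together with one pairing. *)
Lemma annihilatorP P :
  annihilator D P <-> forall u, pairing (P * 'X_[u]) = 0.
Proof.
have fact0 (I : Type) (r : seq I) (F : I -> nat) : (forall i, 0 < F i)%N ->
    (\prod_(i <- r) F i)%N%:R != 0 :> rat.
  move=> F0; rewrite Num.Theory.pnatr_eq0 -lt0n.
  by elim/big_rec: _ => // i x _ x0; rewrite muln_gt0 F0.
split=> [PD u|PD].
  have := mcoeff_diff_op P u; rewrite PD mcoeff0 mulr0 => /esym/eqP.
  rewrite mulf_eq0 (negbTE (fact0 _ _ _ _)) /= => [/eqP //|a].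
  by rewrite muln_gt0 !fact_gt0.
apply/mpolyP => u; rewrite mcoeff0; apply/eqP.
have := mcoeff_diff_op P u; rewrite PD mulr0 => /eqP.
by rewrite mulf_eq0 (negbTE (fact0 _ _ _ _)) // => k; rewrite fact_gt0.
Qed.

Lemma pairing_annihilator P Q : annihilator D P -> pairing (P * Q) = 0.
Proof.
move/annihilatorP => PD; rewrite [Q]mpolyE mulr_sumr pairing_sum big1 // => m _.
by rewrite -scalerAr pairingZ PD mulr0.
Qed.

Lemma ideal_generated_annihilator G P :
  (forall g, G g -> annihilator D g) -> ideal_generated G P -> annihilator D P.
Proof.
move=> GD [s [sG ->]]; apply/annihilatorP => u.
rewrite mulr_suml pairing_sum big_seq big1 // => a /sG/GD aD.
by rewrite mulrC mulrA mulrC pairing_annihilator.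
Qed.

Definition cmnm (c : bool) (f : 'I_n -> nat) : 'X_{1..n + n} :=
  vmnm (fun d i => if d == c then f i else 0%N).

Lemma cmnmE c f d i : cmnm c f (vidx d i) = if d == c then f i else 0%N.
Proof. exact: vmnmE. Qed.

Lemma mpolyX_cmnm c f : 'X_[cmnm c f] = \prod_i zvar c i ^+ f i.
Proof.
rewrite mpolyX_vmnm (bigD1 c) //= eqxx [X in _ * X]big1 ?mulr1 // => d.
by move=> /negbTE ->; apply: big1.
Qed.

Definition shift_cell (c : bool) (k : nat) (a : nat * nat) : nat * nat :=
  if c then ((a.1 + k)%N, a.2) else (a.1, (a.2 + k)%N).

Lemma cell_cmnmD c f m i :
  cell (cmnm c f + m)%MM i = shift_cell c (f i) (cell m i).
Proof. by rewrite /cell !mnmDE !cmnmE; case: c => /=; rewrite add0n addnC. Qed.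

(** The hook is a Young diagram, hence closed under lowering a coordinate. *)
Lemma shift_cell_hook c k a : shift_cell c k a \in hook -> a \in hook.
Proof. by case: a => a b; case: c; rewrite !mem_hook /=; lia. Qed.

Definition shift_mx B c (r : 'I_n -> nat * nat) : 'M[{poly rat}]_n :=
  \matrix_(i, j) \sum_(k < B.+1)
    (shift_cell c k (r i) == nth (0, 0)%N hook j)%:R *: 'X^k.

(** A positive shift moves a biexponent up in the lexicographic order and the zero shift fixes it,
    so the matrix is triangular with ones on the diagonal. *)
Lemma det_shift_mx_hook B c : \det (shift_mx B c (nth (0, 0)%N hook)) = 1.
Proof.
rewrite -det_tr det_trig; last first.
  apply/is_trig_mxP => i j ij; rewrite !mxE big1 // => k _.
  have := nth_hook_lt ij; case: eqP => [<-|]; last by rewrite scale0r.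
  by case: (nth _ _ j) => a b; case: c; rewrite /lex_lt /=; lia.
apply: big1 => i _; rewrite !mxE big_ord_recl big1 => [|k _].
  rewrite addr0 expr0 (_ : _ == _) ?scale1r //.
  by case: (nth _ _ i) => a b; case: c; rewrite /= addn0 eqxx.
case: eqP => [|_]; last by rewrite scale0r.
by case: (nth _ _ i) => a b; case: c => /= -[] /eqP; rewrite /bump /=; lia.
Qed.

(* Multiplying a monomial of Delta by a power of x_i raises the first
   coordinate of one cell; recording the exponents in the powers of 'X turns
   the generating function of all such raisings into unipotent column
   operations. *)
Lemma det_shift_mx B c (m : 'X_{1..n + n}) :
  \det (shift_mx B c (cell m)) = (D@_m)%:P.
Proof.
rewrite mcoeff_Delta -det_map_mx -[RHS]mulr1 -(det_shift_mx_hook B c).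
rewrite -det_mulmx; congr (\det _); apply/matrixP => i j; rewrite !mxE.
case: (boolP (cell m i \in hook)) => [im|inm].
  have lt : (index (cell m i) hook < n)%N.
    by rewrite -[X in (_ < X)%N]size_hook index_mem.
  rewrite (bigD1 (Ordinal lt)) //= [X in _ + X]big1 ?addr0 => [|k kn].
    by rewrite !mxE /= nth_index // eqxx mul1r.
  rewrite !mxE; case: eqP => [e|_]; last by rewrite mul0r.
  case/eqP: kn; apply: val_inj.
  by rewrite [RHS](congr1 (index^~ hook) e) index_uniq ?uniq_hook ?size_hook.
(* A cell outside the hook gives a zero row on both sides, since no shift brings it back into the
   hook. *)
rewrite !big1 // => k _; last first.
  case: eqP => [e|_]; last by rewrite scale0r.
  by rewrite (@shift_cell_hook c k) // e mem_nth // size_hook in inm.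
rewrite !mxE; case: eqP => [e|_]; last by rewrite mul0r.
by rewrite e mem_nth // size_hook in inm.
Qed.

(** The sum is the pairing of [h_d] times the monomial [m], and also the coefficient of ['X^d] in a
    determinant that [det_shift_mx] shows to be constant. *)
Lemma sum_mcoeff_Delta_shift c d m : (0 < d)%N ->
  \sum_(f : {ffun 'I_n -> 'I_d.+1} | (\sum_i f i)%N == d)
    D@_(cmnm c (fun i => f i) + m) = 0.
Proof.
move=> d0; have H : (\det (shift_mx d c (cell m)))`_d = 0.
  by rewrite det_shift_mx coefC gtn_eqF.
apply: etrans H; rewrite coef_sum.
under eq_bigr do rewrite mcoeff_Delta /determinant.
rewrite exchange_big /=; apply: eq_bigr => s _.
rewrite mulr_sign.
pose a i (k : 'I_d.+1) : rat :=
  (shift_cell c k (cell m i) == nth (0, 0)%N hook (s i))%:R.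
have -> : \prod_i shift_mx d c (cell m) i (s i) =
    \prod_i \sum_k a i k *: 'X^k by apply: eq_bigr => i _; rewrite mxE.
under eq_bigr do under eq_bigr do rewrite mxE cell_cmnmD.
rewrite -mulr_sumr -[X in _ * X](coef_prod_sumX a) mulr_sign.
by case: odd_perm; rewrite ?coefN.
Qed.

(** A monomial of Delta involves exactly [L] of the x's and [K] of the y's, and its cells lie on the
    axes, so no multiple of a monomial generator occurs in Delta. *)
Lemma hook_generator_annihilator g : hook_generator K L g -> annihilator D g.
Proof.
have hom c d : (1 <= d <= n)%N -> annihilator D (complete_hom d (@zvar n c)).
  case/andP => d0 _; apply/annihilatorP => u.
  rewrite (complete_hom_ffun _ (leqnn d)) mulr_suml pairing_sum.
  rewrite -[RHS](sum_mcoeff_Delta_shift c u d0); apply: eq_bigr => f _.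
  by rewrite -mpolyX_cmnm -mpolyXD pairingX.
have prod c (A : {set 'I_n}) : #|A| = (arm c).+1 ->
    annihilator D (\prod_(i in A) zvar c i).
  move=> cA; apply/annihilatorP => u.
  rewrite /zvar mprodXE -mpolyXD pairingX; apply/eqP; apply: contraT.
  move/mcoeff_Delta_neq0/(card_cells_supp c) => cS.
  suff /subset_leq_card : A \subset
      [set i | 0 < (\sum_(i in A) U_(vidx c i) + u)%MM (vidx c i)]%N.
    by rewrite cS cA ltnn.
  apply/subsetP => i iA; rewrite inE mnmDE mnm_sumE (bigD1 i) //=.
  by rewrite mnm1E eqxx.
case=> [i|i|i|A|A]; [exact: (hom true)|exact: (hom false)| |
  exact: (prod true)|exact: (prod false)].
apply/annihilatorP => u; rewrite -!mpolyXD pairingX; apply/eqP.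
apply: contraT => /mcoeff_Delta_neq0/(cells_permute_hook_mem i).
by rewrite /cell mem_hook !mnmDE !mnm1E !eqxx; lia.
Qed.

(** * Shelling *)

(* A facet (i, A) is a word in two letters x and y with one hole: A is the set
   of positions of the L letters x, and i is the position of the hole. *)
Definition is_facet (F : 'I_n * {set 'I_n}) : bool :=
  (F.1 \notin F.2) && (#|F.2| == L).

Definition side (F : 'I_n * {set 'I_n}) (c : bool) : {set 'I_n} :=
  if c then F.2 else ~: (F.1 |: F.2).

Definition restr (F : 'I_n * {set 'I_n}) (c : bool) (j : 'I_n) : bool :=
  (j \in side F c) && (if c then F.1 < j else j < F.1)%N.

Definition letter (F : 'I_n * {set 'I_n}) (j : 'I_n) : nat :=
  if j \in F.2 then 0%N else if j == F.1 then 1%N else 2%N.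

(** The lexicographic order as a number, which allows induction on [nat]. The default digit of
    [oapp] is never read, as all positions are below [n]. *)
Definition facet_rank (F : 'I_n * {set 'I_n}) : nat :=
  base3 (fun k => oapp (letter F) 0%N (insub k)) n.

Lemma card_side F c : is_facet F -> #|side F c| = arm c.
Proof.
case/andP => iA /eqP cA; case: c => //=.
have := cardsC (F.1 |: F.2); rewrite cardsU1 iA cA card_ord /=.
by move: (#|~: _|) => k; lia.
Qed.

Lemma side_inj F c d i : i \in side F c -> i \in side F d -> c = d.
Proof.
by case: c d => [] [] //=; rewrite !inE negb_or;
  case: (i \in F.2); rewrite ?andbF.
Qed.

Lemma facet_rank_lt F G (p : 'I_n) :
  (forall j : 'I_n, j < p -> letter F j = letter G j)%N ->
  (letter F p < letter G p)%N -> (facet_rank F < facet_rank G)%N.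
Proof.
move=> eqFG ltFG; apply: (@base3_lt _ _ p) => // [j jp||j].
- have jn := ltn_trans jp (ltn_ord p).
  by rewrite (insubT (fun k => k < n)%N jn) /= eqFG.
- by rewrite !valK.
by case: insubP => //= k _ _; rewrite /letter; case: ifP => // _; case: ifP.
Qed.

Lemma letter_cmp F G (i : 'I_n) :
  (forall j : 'I_n, j < i -> letter F j <= letter G j)%N ->
  (facet_rank F < facet_rank G)%N \/
  (forall j : 'I_n, j < i -> letter F j = letter G j)%N.
Proof.
move=> le.
case: (pickP [pred j : 'I_n | (j < i)%N && (letter F j != letter G j)]).
  move=> j0 j0P; left.
  case: (arg_minnP (fun j : 'I_n => nat_of_ord j) j0P) => p /andP[pi np] pmin.
  apply: (@facet_rank_lt _ _ p); last by rewrite ltn_neqAle np le.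
  move=> j jp; apply/eqP; apply: contraT => nj.
  have := pmin j; rewrite /= nj andbT (ltn_trans jp pi) leqNgt jp.
  by move=> /(_ isT).
move=> no; right => j ji; apply/eqP; apply: contraT => nj.
by have := no j; rewrite /= ji nj.
Qed.

(** This is the shelling property. Left of the hole of [F] the y's of [F] stay y's in [G], so [G] is
    not smaller there. If the words agree there, the x's right of the hole force equal sets of x's,
    and a different hole makes [G] larger. *)
Lemma restr_sub_facet F G : is_facet F -> is_facet G ->
  (forall c j, restr F c j -> j \in side G c) ->
  F = G \/ (facet_rank F < facet_rank G)%N.
Proof.
case: F => i A; case: G => i' A' FF FG sub; have [iA] := andP FF.
move=> /= /eqP cA; have [iA'] := andP FG; move=> /= /eqP cA'.
have [|lt|eqFG] := @letter_cmp (i, A) (i', A') i; [|by right|].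
  move=> j ji; have /= := sub false j; rewrite /restr /letter /= !inE ji.
  by case: (j \in A) => //; rewrite -val_eqE (ltn_eqF ji) /= => /(_ isT);
    rewrite negb_or => /andP[/negbTE -> /negbTE ->].
have AA' : A = A'.
  apply/eqP; rewrite eqEcard cA cA' leqnn andbT; apply/subsetP => j jA.
  case: (ltngtP j i) => [ji|ij|/val_inj ji].
  - by have := eqFG j ji; rewrite /letter /= jA; case: ifP => // _; case: ifP.
  - by have := sub true j; rewrite /restr /= jA ij; apply.
  by rewrite -ji jA in iA.
rewrite -AA' in eqFG *; case: (eqVneq i i') => [->|ii']; [by left|right].
apply: (@facet_rank_lt _ _ i) => //.
by rewrite /letter /= (negbTE iA) eqxx (negbTE ii').
Qed.

(** The shelling property for the reversed order, with the roles of x and y exchanged: here the x's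
    left of the hole and the y's right of it are kept. *)
Lemma corestr_sub_facet F G : is_facet F -> is_facet G ->
  (forall c j, j \in side F c -> ~~ restr F c j -> j \in side G c) ->
  G = F \/ (facet_rank G < facet_rank F)%N.
Proof.
move=> FF FG sub; have cF := card_side false FF; have cG := card_side false FG.
case: F FF sub cF => i A; case: G FG cG => i' A' FG cG FF sub cF.
have [iA] := andP FF; move=> /= /eqP cA.
have [iA'] := andP FG; move=> /= /eqP cA'.
have [|lt|eqFG] := @letter_cmp (i', A') (i, A) i; [|by right|].
  move=> j ji; have /= := sub true j; rewrite /restr /letter /=.
  case: (j \in A) => [|_]; last first.
    have /negbTE -> : j != i by rewrite -val_eqE (ltn_eqF ji).
    by case: ifP => // _; case: ifP.
  by rewrite ltnNge (ltnW ji) => /(_ isT isT) ->.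
have AA' : side (i, A) false = side (i', A') false.
  apply/eqP; rewrite eqEcard cF cG leqnn andbT; apply/subsetP => j jA.
  have := jA; rewrite /= !inE negb_or => /andP[nji njA].
  case: (ltngtP j i) => [ji|ij|/val_inj ji]; last by rewrite ji eqxx in nji.
    have := eqFG j ji; rewrite /letter /= (negbTE nji) (negbTE njA).
    by case: ifP => // _; case: ifP.
  have := sub false j jA; rewrite /restr jA /= ltnNge (ltnW ij) => /(_ isT).
  by rewrite !inE.
have : i \notin side (i', A') false by rewrite -AA' /= !inE eqxx.
rewrite /= !inE negbK => /orP[/eqP ii'|iA2].
  left; rewrite ii'; congr pair; apply/setP => j.
  move/setP/(_ j): AA'; rewrite /= !inE ii'.
  case: (eqVneq j i') => [->|] /=; last by move=> _ /negb_inj.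
  by rewrite (negbTE iA') -ii' (negbTE iA).
right; apply: (@facet_rank_lt _ _ i) => //.
by rewrite /letter /= iA2 (negbTE iA) eqxx.
Qed.

(** Among the positions outside [S], the first [L - #|S true|] receive x, the next one is the hole
    and the others receive y. The added x's lie left of the hole and the added y's right of it,
    hence outside the restriction. *)
Lemma face_facet (S : bool -> {set 'I_n}) :
  [disjoint S true & S false] -> (forall c, #|S c| <= arm c)%N ->
  exists F, [/\ is_facet F, forall c j, j \in S c -> j \in side F c
    & forall c j, restr F c j -> j \in S c].
Proof.
move=> dis le; have leL := le true; have leK := le false; rewrite /= in leL leK.
pose U := ~: (S true :|: S false).
have cU : (#|U| + #|S true| + #|S false| = n)%N.
  have := cardsC (S true :|: S false); rewrite card_ord -/U.
  by rewrite cardsU (disjoint_setI0 dis) cards0; lia.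
pose f k := #|[set u in U | u < k]%N|.
have fS (k : 'I_n) : f k.+1 = ((k \in U) + f k)%N.
  rewrite /f; case: (boolP (k \in U)) => kU.
    rewrite (_ : [set u in U | u < k.+1]%N = k |: [set u in U | u < k]%N).
      by rewrite cardsU1 inE ltnn andbF.
    apply/setP => u; rewrite !inE ltnS leq_eqVlt.
    case: (eqVneq u k) => [->|uk]; first by move: kU; rewrite !inE eqxx => ->.
    by have /negbTE -> : u != k :> nat by [].
  apply: eq_card => u; rewrite !inE ltnS leq_eqVlt.
  case: (eqVneq u k) => [->|uk]; last by have /negbTE -> : u != k :> nat by [].
  by move: kU; rewrite !inE => /negbTE ->.
have fn : f n = #|U| by apply: eq_card => u; rewrite !inE ltn_ord andbT.
have f0 : f 0%N = 0%N by apply: eq_card0 => u; rewrite !inE andbF.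
have ltU : (L - #|S true| < #|U|)%N.
  by move: cU leL leK; move: #|U| #|S true| #|S false| => a b c; lia.
have ex : exists k, (L - #|S true| < f k)%N by exists n; rewrite fn.
(* The minimum is the successor of the hole, since [f] counts the free positions strictly below its
   argument. *)
case: (ex_minnP ex) => -[|k] kP kmin; first by rewrite f0 in kP.
have kn : (k < n)%N by apply: kmin; rewrite fn.
pose i := Ordinal kn.
have fi : (f i <= L - #|S true|)%N.
  by rewrite leqNgt; apply/negP => /kmin; rewrite ltnn.
have := fS i; rewrite /= in fi * => fSi.
have iU : i \in U by move: kP fi; rewrite fSi; case: (i \in U) => //=; lia.
have fiE : f i = (L - #|S true|)%N by move: kP fi; rewrite fSi iU /=; lia.
pose A := S true :|: [set u in U | u < i]%N.
have iS c : i \notin S c by move: iU; rewrite !inE negb_or; case: c => /andP[].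
have disA : [disjoint S true & [set u in U | u < i]%N].
  rewrite disjoint_subset; apply/subsetP => u uS.
  by rewrite !inE uS.
exists (i, A); split.
- apply/andP; split; rewrite /= ?inE ?(negbTE (iS true)) ?ltnn ?andbF //.
  by rewrite cardsU (disjoint_setI0 disA) cards0 -/(f i) fiE subn0 subnKC.
- case=> j jS /=; first by rewrite !inE jS.
  rewrite !inE jS orbT /= orbF negb_or (disjointFl dis jS) andbT.
  by apply: contraTneq jS => ->; apply: iS.
case=> j; rewrite /restr /= !inE.
  by case/andP => /orP[//|/andP[_ ji]] ij; rewrite ltnNge (ltnW ij) in ji.
rewrite !negb_or => /andP[/and3P[_ jS]]; rewrite (negbTE jS) /=.
by rewrite negb_and negbK => /orP[//|nji] ji; rewrite ji in nji.
Qed.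

Lemma cells_permute_hook_facet m : cells_permute_hook m ->
  exists2 G, is_facet G & forall c j, (0 < m (vidx c j))%N = (j \in side G c).
Proof.
move=> mP; pose S c := [set i | 0 < m (vidx c i)]%N.
have cS c : #|S c| = arm c by apply: card_cells_supp.
have dis : [disjoint S true & S false].
  rewrite disjoint_subset; apply/subsetP => i; rewrite !inE.
  by have := cells_permute_hook_mem i mP; rewrite /cell mem_hook; lia.
have [|F [FF SF _]] := @face_facet S dis; first by move=> c; rewrite cS.
exists F => // c j; have -> : side F c = S c; last by rewrite inE.
apply/esym/eqP; rewrite eqEcard cS card_side // leqnn andbT.
by apply/subsetP => k; apply: SF.
Qed.

(** * Reduction to normal monomials *)

Local Notation J := (ideal_generated (@hook_generator K L n)).

Lemma ideal_mixed (m : 'X_{1..n + n}) i :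
  (0 < m (vidx true i))%N -> (0 < m (vidx false i))%N -> J 'X_[m].
Proof.
move=> mx my; pose u := (U_(vidx true i) + U_(vidx false i))%MM.
have um : (u <= m)%MM.
  apply/mnm_lepP => k; rewrite mnmDE !mnm1E.
  case: (eqVneq (vidx true i) k) => [<-|_]; first by rewrite eq_vidx.
  by case: eqVneq => [<-|].
rewrite -(submK um) mpolyXD; apply: ideal_generatedM.
by rewrite mpolyXD; apply: ideal_generated_gen; apply: gen_xy.
Qed.

(** Together with [ideal_mixed], this puts every monomial whose support is not a face into the
    ideal. *)
Lemma ideal_large_supp c (m : 'X_{1..n + n}) :
  (arm c < #|[set i | 0 < m (vidx c i)]|)%N -> J 'X_[m].
Proof.
set S := [set i | _] => cS.
have /card_gt0P[A] :
    (0 < #|[set A : {set 'I_n} | A \subset S & #|A| == (arm c).+1]|)%N.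
  by rewrite cards_draws bin_gt0.
rewrite inE => /andP[AS /eqP cA].
have um : (\sum_(i in A) U_(vidx c i) <= m)%MM.
  apply/mnm_lepP => k; rewrite mnm_sumE.
  case: (pickP [pred i in A | vidx c i == k]) => [i /andP[/= iA /eqP <-]|no].
    rewrite (bigD1 i) //= big1 => [|j /andP[_ ji]]; last first.
      by rewrite mnm1E eq_vidx (negbTE ji) andbF.
    by have := subsetP AS i iA; rewrite inE mnm1E eqxx addn0.
  rewrite big1 // => i iA; rewrite mnm1E.
  by have := no i; rewrite /= iA => /= ->.
rewrite -(submK um) mpolyXD; apply: ideal_generatedM; rewrite -mprodXE.
apply: ideal_generated_gen; case: c cA {S cS AS um}; first exact: gen_prodx.
exact: gen_prody.
Qed.

(** Equal letters of [F] are numbered 1, 2, ... from left to right; these are the exponents of the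
    largest monomial on [F]. *)
Definition top_exp (F : 'I_n * {set 'I_n}) (c : bool) (j : 'I_n) : nat :=
  if j \in side F c then #|[set a in side F c | a <= j]%N| else 0%N.

Definition above F (m : 'X_{1..n + n}) : Prop :=
  forall c j, restr F c j -> (0 < m (vidx c j))%N.

(** On a side, the bound allows the restriction monomial times a staircase monomial with exponents
    at most [top_exp - 1]; off the side it forces exponent 0. *)
Definition normal F (m : 'X_{1..n + n}) : Prop :=
  above F m /\ forall c j,
    (m (vidx c j) + (j \in side F c) <= top_exp F c j + restr F c j)%N.

Definition reducible (P : {mpoly rat[n + n]}) : Prop :=
  exists R, J (P - R) /\
    forall m, m \in msupp R -> exists2 F, is_facet F & normal F m.

Lemma reducible_ideal P : J P -> reducible P.
Proof. by exists 0; split=> [|m]; rewrite ?subr0 // msupp0. Qed.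

Lemma reducible0 : reducible 0.
Proof. exact/reducible_ideal/ideal_generated0. Qed.

Lemma reducibleD P Q : reducible P -> reducible Q -> reducible (P + Q).
Proof.
move=> [R [JR nR]] [S [JS nS]]; exists (R + S); split.
  by rewrite opprD addrACA; apply: ideal_generatedD.
by move=> m /msuppD_le; rewrite mem_cat => /orP[/nR|/nS].
Qed.

Lemma reducibleZ a P : reducible P -> reducible (a *: P).
Proof.
move=> [R [JR nR]]; exists (a *: R); split; last by move=> m /msuppZ_le/nR.
by rewrite -scalerBr -mul_mpolyC; apply: ideal_generatedM.
Qed.

Lemma reducibleB P Q : reducible P -> reducible Q -> reducible (P - Q).
Proof.
by move=> rP rQ; apply: reducibleD rP _; rewrite -scaleN1r; apply: reducibleZ.
Qed.

Lemma reducible_sum I (r : seq I) (A : pred I) (F : I -> {mpoly rat[n + n]}) :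
  (forall i, A i -> reducible (F i)) -> reducible (\sum_(i <- r | A i) F i).
Proof.
by move=> H; apply: big_ind => //; [exact: reducible0 | exact: reducibleD].
Qed.

Lemma top_exp_lt F c i j : i \in side F c -> j \in side F c ->
  (i < j)%N -> (top_exp F c i < top_exp F c j)%N.
Proof.
move=> iF jF ij; rewrite /top_exp iF jF; apply/proper_card/properP; split.
  apply/subsetP => a; rewrite !inE => /andP[-> ai] /=.
  exact: leq_trans ai (ltnW ij).
by exists j; rewrite !inE jF ?leqnn // leqNgt ij.
Qed.

Lemma top_exp_le F c j : is_facet F -> (top_exp F c j <= arm c)%N.
Proof.
move=> FF; rewrite /top_exp -(card_side c FF); case: ifP => // _.
by apply: subset_leq_card; apply/subsetP => a; rewrite inE => /andP[].
Qed.

Lemma top_exp_gt0 F c j : (0 < top_exp F c j)%N = (j \in side F c).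
Proof.
rewrite /top_exp; case: ifP => // jF.
by apply/card_gt0P; exists j; rewrite inE jF leqnn.
Qed.

(** Substituting 0 outside [T] expresses [h_d] in fewer variables without changing the index
    type. *)
Definition zsub c (T : {set 'I_n}) (i : 'I_n) : {mpoly rat[n + n]} :=
  if i \in T then zvar c i else 0.

Lemma complete_hom_zsub d c T : complete_hom d (zsub c T) =
  \sum_(f : {ffun 'I_n -> 'I_d.+1} | ((\sum_i f i)%N == d)
      && [forall i, (i \in T) || (f i == 0 :> nat)%N])
    'X_[cmnm c (fun i => f i)].
Proof.
rewrite (complete_hom_ffun _ (leqnn d)) big_mkcondr; apply: eq_bigr => f _.
rewrite mpolyX_cmnm; case: ifP => [/forallP fT|/negbT/forallPn[i]].
  apply: eq_bigr => i _; rewrite /zsub; have := fT i.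
  by case: ifP => //= _ /eqP ->; rewrite !expr0.
rewrite negb_or => /andP[iT fi].
by rewrite (bigD1 i) //= /zsub (negbTE iT) expr0n (negbTE fi) mul0r.
Qed.

Section FacetReduction.

Variable F : 'I_n * {set 'I_n}.
Hypothesis facetF : is_facet F.
Hypothesis larger_rank : forall G, is_facet G ->
  (facet_rank F < facet_rank G)%N -> forall m, above G m -> reducible 'X_[m].

Lemma aboveD (u m : 'X_{1..n + n}) : above F u -> above F (u + m)%MM.
Proof. by move=> uF c j /uF; rewrite mnmDE; apply: ltn_addr. Qed.

(** If the support is a face, the facet [G] assigned to it by [face_facet] contains the restriction
    of [F] and differs from [F], so it has larger rank. *)
Lemma reducible_off_facet m c j : above F m -> (0 < m (vidx c j))%N ->
  j \notin side F c -> reducible 'X_[m].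
Proof.
move=> mF mj jF; pose S d := [set i | 0 < m (vidx d i)]%N.
case: (boolP [disjoint S true & S false]) => [dis|]; last first.
  rewrite -setI_eq0 => /set0Pn[i]; rewrite !inE => /andP[mx my].
  exact/reducible_ideal/(ideal_mixed mx my).
case: (pickP (fun d => (arm d < #|S d|)%N)) => [d dS|small].
  exact/reducible_ideal/(ideal_large_supp dS).
have [|G [FG SG GS]] := face_facet dis; first by move=> d; rewrite leqNgt small.
have GF d i : restr G d i -> (0 < m (vidx d i))%N by move/GS; rewrite inE.
have [] := restr_sub_facet facetF FG.
- by move=> d i /mF mi; apply: SG; rewrite inE.
- by move=> FeqG; rewrite FeqG SG ?inE in jF.
by move=> ltFG; apply: (larger_rank FG ltFG).
Qed.

(* For T the whole side this is h_d itself, up to monomials that leave F; the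
   variables outside T are then dropped one at a time, each lowering d. *)
Lemma reducible_complete_hom c (T : {set 'I_n}) d u : T \subset side F c ->
  (#|side F c :\: T| < d <= n)%N -> above F u ->
  reducible ('X_[u] * complete_hom d (zsub c T)).
Proof.
move: {2}#|_|%N (leqnn #|side F c :\: T|) => k.
elim: k T d u => [|k IH] T d u; rewrite ?leqn0 ?cards_eq0.
  rewrite setD_eq0 => sF Ts /andP[d0 dn] uF.
  have {Ts sF} -> : T = side F c by apply/eqP; rewrite eqEsubset Ts sF.
  have -> : complete_hom d (zsub c (side F c)) =
      complete_hom d (@zvar n c) - \sum_(f : {ffun 'I_n -> 'I_d.+1} |
        ((\sum_i f i)%N == d) &&
        ~~ [forall i, (i \in side F c) || (f i == 0 :> nat)%N])
      'X_[cmnm c (fun i => f i)].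
    apply/eqP; rewrite eq_sym subr_eq complete_hom_zsub.
    rewrite (complete_hom_ffun _ (leqnn d)); apply/eqP.
    rewrite (bigID (fun f : {ffun 'I_n -> 'I_d.+1} =>
      [forall i, (i \in side F c) || (f i == 0 :> nat)%N])) /=.
    by congr (_ + _); apply: eq_bigr => f _; rewrite mpolyX_cmnm.
  rewrite mulrBr; apply: reducibleB.
    apply: reducible_ideal; apply: ideal_generatedM; apply: ideal_generated_gen.
    have d1n : (1 <= d <= n)%N by rewrite dn andbT; apply: leq_ltn_trans d0.
    by case: (c); [exact: gen_hx | exact: gen_hy].
  rewrite mulr_sumr; apply: reducible_sum => f /andP[_ /forallPn[i]].
  rewrite negb_or => /andP[iF fi]; rewrite -mpolyXD.
  apply: (@reducible_off_facet _ c i) => //; first exact: aboveD.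
  by rewrite mnmDE cmnmE eqxx addn_gt0 orbC lt0n fi.
move=> le Ts /andP[lt_d dn] uF.
case: (posnP #|side F c :\: T|) => [c0|/card_gt0P[a]].
  by apply: IH; rewrite ?c0 // dn andbT; lia.
rewrite inE => /andP[aT aF].
have cD : #|side F c :\: T| = #|side F c :\: (a |: T)|.+1.
  by rewrite (cardsD1 a) inE aT aF setDDl setUC add1n.
case: d lt_d dn => [//|d] lt_d dn.
have sT : a |: T \subset side F c by rewrite subUset sub1set aF.
(* Adding [a] to [T] lowers the number of missing variables by one, which keeps it below the degree
   even in the term where the degree drops. *)
have -> : complete_hom d.+1 (zsub c T) =
    complete_hom d.+1 (zsub c (a |: T)) -
    zvar c a * complete_hom d (zsub c (a |: T)).
  rewrite (@complete_hom_rec _ _ _ (zsub c (a |: T)) (zsub c T) a).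
  - have -> : zsub c (a |: T) a = zvar c a by rewrite /zsub setU11.
    by rewrite addrK.
  - by rewrite /zsub (negbTE aT).
  by move=> i ia; rewrite /zsub !inE (negbTE ia).
rewrite mulrBr; apply: reducibleB.
  by apply: IH => //; rewrite ?dn ?andbT; lia.
rewrite mulrA -mpolyXD; apply: IH => //; last exact: aboveD; lia.
Qed.

Definition weight (m : 'X_{1..n + n}) : nat :=
  (\sum_k vmnm (top_exp F) k * m k)%N.

Lemma weightD u m : weight (u + m)%MM = (weight u + weight m)%N.
Proof.
by rewrite -big_split; apply: eq_bigr => k _ /=; rewrite mnmDE mulnDr.
Qed.

Lemma weight_cmnm c f : weight (cmnm c f) = (\sum_i top_exp F c i * f i)%N.
Proof.
rewrite /weight (big_vidx addn) (bigD1 c) //= [X in (_ + X)%N]big1 => [|d dc].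
  by rewrite addn0; apply: eq_bigr => i _; rewrite vmnmE cmnmE eqxx.
by apply: big1 => i _; rewrite cmnmE (negbTE dc) muln0.
Qed.

Lemma mdeg_cmnm c f : mdeg (cmnm c f) = (\sum_i f i)%N.
Proof.
rewrite mdegE (big_vidx addn) (bigD1 c) //= [X in (_ + X)%N]big1 => [|d dc].
  by rewrite addn0; apply: eq_bigr => i _; rewrite cmnmE eqxx.
by apply: big1 => i _; rewrite cmnmE (negbTE dc).
Qed.

(** The bound depends on the degree alone, so a rewriting that keeps the degree and raises the
    weight terminates. *)
Lemma weight_le m : (weight m <= n * mdeg m)%N.
Proof.
rewrite mdegE big_distrr /weight !(big_vidx addn) /=.
apply: leq_sum => c _; apply: leq_sum => i _; rewrite leq_mul2r vmnmE.
apply/orP; right; apply: leq_trans (top_exp_le c i facetF) _.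
by case: c => /=; lia.
Qed.

(* If the exponent of z_j exceeds its bound d - 1, the relation h_d in the
   variables of the same letter at positions >= j rewrites the monomial into
   monomials of larger weight. *)
Lemma reducible_above m : above F m -> reducible 'X_[m].
Proof.
have [k] := ubnP (n * mdeg m - weight m)%N; elim: k m => // k IH m.
rewrite ltnS => le_k mF.
case: (pickP (fun cj : bool * 'I_n =>
    (0 < m (vidx cj.1 cj.2))%N && (cj.2 \notin side F cj.1)))
  => [[c j] /andP[mj jF]|supp_m].
  exact: reducible_off_facet mF mj jF.
case: (pickP (fun cj : bool * 'I_n => (top_exp F cj.1 cj.2 + restr F cj.1 cj.2 <
    m (vidx cj.1 cj.2) + (cj.2 \in side F cj.1))%N))
  => [[c j] /= big|nrm]; last first.
  exists 'X_[m]; rewrite subrr; split; first exact: ideal_generated0.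
  move=> m'; rewrite msuppX inE => /eqP ->; exists F => //; split=> // c j.
  by rewrite leqNgt (nrm (c, j)).
have jF : j \in side F c.
  have := supp_m (c, j); rewrite /=; case: (j \in side F c) big => //=.
  rewrite addn0 andbT => big0 /negbT; rewrite -leqNgt leqn0 => /eqP m0.
  by rewrite m0 in big0.
rewrite jF addn1 ltnS in big; set d := top_exp F c j in big.
have d0 : (0 < d)%N by rewrite top_exp_gt0.
have dn : (d <= n)%N.
  by apply: leq_trans (top_exp_le c j facetF) _; case: (c) => /=; lia.
pose f0 : {ffun 'I_n -> 'I_d.+1} :=
  [ffun i => if i == j then ord_max else ord0].
have f0E i : f0 i = (if i == j then d else 0%N) :> nat.
  by rewrite ffunE; case: ifP.
pose u := (m - cmnm c (fun i => f0 i))%MM.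
have um : (u + cmnm c (fun i => f0 i))%MM = m.
  rewrite submK //; apply/mnm_lepP => h; rewrite -(splitK h).
  have cle b i : (cmnm c (fun i => f0 i) (vidx b i) <= m (vidx b i))%N.
    rewrite cmnmE; case: eqP => // ->; rewrite f0E; case: eqP => // ->.
    by apply: leq_trans big; apply: leq_addr.
  by case: (split h) => i; [apply: (cle true) | apply: (cle false)].
(* If [j] lies in the restriction, [big] provides one more factor than the [d] that are removed. *)
have uF : above F u.
  move=> b i bi; rewrite mnmBE cmnmE; have m0 := mF b i bi.
  case: eqP => [bc|]; last by rewrite subn0.
  rewrite f0E; case: eqP => [ij|]; last by rewrite subn0.
  by move: bi big; rewrite bc ij => ->; rewrite addn1 subn_gt0.
pose T := [set a in side F c | j <= a]%N.
have TF : T \subset side F c by apply/subsetP => a; rewrite inE => /andP[].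
(* The letters missing from [T] lie strictly left of [j], whereas [d] also counts [j]. *)
have cT : (#|side F c :\: T| < d)%N.
  rewrite /d /top_exp jF; apply: proper_card; apply/properP; split.
    apply/subsetP => a; rewrite !inE => /andP[+ aF].
    by rewrite aF /= -ltnNge => /ltnW.
  by exists j; rewrite !inE jF ?leqnn.
have := @reducible_complete_hom c T d u TF _ uF; rewrite cT dn => /(_ isT).
have f0d : (\sum_i f0 i)%N = d.
  rewrite (bigD1 j) //= f0E eqxx big1 ?addn0 // => i ij.
  by rewrite f0E (negbTE ij).
rewrite complete_hom_zsub mulr_sumr (bigD1 f0) /=; last first.
  rewrite f0d eqxx; apply/forallP => i; rewrite f0E !inE.
  by case: (eqVneq i j) => [->|_]; rewrite ?jF ?leqnn ?orbT.
rewrite -mpolyXD um; set rest := \sum_(_ | _) _ => H.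
rewrite -['X_[m]](addrK rest); apply: reducibleB H _.
apply: reducible_sum => f /andP[/andP[/eqP fd /forallP fT] ff0].
rewrite -mpolyXD; apply: IH; last exact: aboveD.
have deg : mdeg (u + cmnm c (fun i => f i))%MM = mdeg m.
  by rewrite -um !mdegD !mdeg_cmnm fd f0d.
suff lt_w : (weight m < weight (u + cmnm c (fun i => f i)))%N.
  have := weight_le (u + cmnm c (fun i => f i))%MM; rewrite deg.
  move: lt_w le_k; move: (weight m) (weight (u + _)%MM) (n * _)%N => a b e; lia.
rewrite -{1}um !weightD ltn_add2l !weight_cmnm.
have -> : (\sum_i top_exp F c i * f0 i = \sum_i d * f i)%N.
  rewrite -big_distrr /= fd (bigD1 j) //= f0E eqxx big1 ?addn0 // => i ij.
  by rewrite f0E (negbTE ij) muln0.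
have le_f i : (d * f i <= top_exp F c i * f i)%N.
  have := fT i; case: (posnP (f i)) => [->|f0']; first by rewrite !muln0.
  rewrite orbF inE => /andP[iF]; rewrite leq_mul2r leq_eqVlt.
  case/orP=> [/eqP/val_inj <-|ij].
    by rewrite leqnn orbT.
  by rewrite (ltnW (top_exp_lt jF iF ij)) orbT.
(* A term other than [f0] uses some variable strictly right of [j], where [top_exp] exceeds [d];
   this makes the weight grow strictly. *)
have [i ij fi] : exists2 i, i != j & (0 < f i)%N.
  case: (pickP (fun i => (i != j) && (0 < f i)%N)) => [i /andP[]|f0'].
    by exists i.
  case/eqP: ff0; apply/ffunP => i; apply: val_inj; rewrite /= f0E.
  have z i' : i' != j -> f i' = 0 :> nat.
    by move=> ij; have := f0' i'; rewrite ij lt0n => /negbFE/eqP.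
  case: eqP => [->|/eqP]; last exact: z.
  by apply: etrans fd; rewrite (bigD1 j) //= big1 ?addn0.
rewrite (bigD1 i) //= [X in (_ < X)%N](bigD1 i) //= -addSn.
apply: leq_add; last by apply: leq_sum => h _; apply: le_f.
rewrite ltn_mul2r fi /=; have := fT i; rewrite gtn_eqF // orbF inE.
case/andP=> iF ji.
by apply: top_exp_lt => //; rewrite ltn_neqAle ji andbT eq_sym.
Qed.

End FacetReduction.

(** Downward induction on the rank discharges the hypothesis [larger_rank]. *)
Lemma reducible_facet F m : is_facet F -> above F m -> reducible 'X_[m].
Proof.
pose B := (\max_F facet_rank F)%N.
have [k] := ubnP (B - facet_rank F)%N; elim: k F m => // k IH F m le_k FF mF.
apply: (reducible_above FF) => // G FG ltFG u uG; apply: (IH G) => //.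
have leB : (facet_rank G <= B)%N by apply: (leq_bigmax G).
by move: le_k ltFG leB; lia.
Qed.

Lemma reducibleT P : reducible P.
Proof.
rewrite [P]mpolyE; apply: reducible_sum => m _; apply: reducibleZ.
pose S d := [set i | 0 < m (vidx d i)]%N.
case: (boolP [disjoint S true & S false]) => [dis|]; last first.
  rewrite -setI_eq0 => /set0Pn[i]; rewrite !inE => /andP[mx my].
  exact/reducible_ideal/(ideal_mixed mx my).
case: (pickP (fun d => (arm d < #|S d|)%N)) => [d dS|small].
  exact/reducible_ideal/(ideal_large_supp dS).
have [|G [FG SG GS]] := face_facet dis; first by move=> d; rewrite leqNgt small.
by apply: (reducible_facet FG) => c j /GS; rewrite inE.
Qed.

(** * Independence of the normal monomials *)

(** The x's occupy the cells (1,0), ..., (L,0), the y's (0,1), ..., (0,K) and the hole (0,0). *)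
Lemma mcoeff_Delta_top F : is_facet F -> D@_(vmnm (top_exp F)) != 0.
Proof.
move=> FF; apply/mcoeff_Delta_neq0.
apply: cells_permute_hook_inj => [i j|i]; last first.
  rewrite /cell !vmnmE mem_hook.
  have [] := (top_exp_le true i FF, top_exp_le false i FF) => /= leL leK.
  case: (boolP (i \in side F true)) => iF; last first.
    by move: iF; rewrite -top_exp_gt0 leK; lia.
  have : i \notin side F false by apply: contraTN isT => /(side_inj iF).
  by rewrite -top_exp_gt0 leL orbC; lia.
move=> eq_ij; have {}eq_ij c : top_exp F c i = top_exp F c j.
  by have := congr1 (coord c) eq_ij; rewrite !coord_cell !vmnmE.
have sideE c : (i \in side F c) = (j \in side F c).
  by rewrite -!top_exp_gt0 eq_ij.
case: (pickP (fun c => i \in side F c)) => [c iF|nF].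
  have jF := iF; rewrite sideE in jF.
  case: (ltngtP i j) => [/(top_exp_lt iF jF)|/(top_exp_lt jF iF)|/val_inj //];
    by rewrite eq_ij ltnn.
have hole a : (forall c, a \in side F c = false) -> a = F.1.
  move=> aF; have := aF true; have := aF false; rewrite /= !inE => + aA.
  by rewrite aA orbF => /negbFE/eqP.
by rewrite (hole i nF) [in RHS](hole j) // => c; rewrite -sideE nF.
Qed.

Lemma normal_le_top F m : normal F m -> (m <= vmnm (top_exp F))%MM.
Proof.
move=> [_ mF]; apply/mnm_lepP => h; rewrite -(splitK h).
have le c i : (m (vidx c i) <= vmnm (top_exp F) (vidx c i))%N.
  rewrite vmnmE; have := mF c i; rewrite /restr.
  by case: (i \in side F c); case: ifP => _ /=; lia.
by case: (split h) => i; [apply: (le true) | apply: (le false)].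
Qed.

(* Both monomials have the same sum of squares of exponents, so this is the
   equality case of Cauchy-Schwarz. *)
Lemma weight_lt F m : cells_permute_hook m ->
  cells_permute_hook (vmnm (top_exp F)) -> m != vmnm (top_exp F) ->
  (weight F m < weight F (vmnm (top_exp F)))%N.
Proof.
set t := vmnm _ => mP tP mt.
have sq v : cells_permute_hook v ->
    (\sum_k v k ^ 2 = \sum_(a <- hook) (a.1 ^ 2 + a.2 ^ 2))%N.
  move=> vP; rewrite (big_vidx addn) big_bool -big_split.
  exact: (big_cells_hook addn (fun a => a.1 ^ 2 + a.2 ^ 2)%N vP).
have [k mk] : exists k, m k != t k.
  apply/existsP; apply: contraR mt => /existsPn eq_mt.
  by apply/eqP/mnmP => k; apply/eqP; have := eq_mt k; rewrite negbK.
suff : (\sum_k 2 * (t k * m k) < \sum_k 2 * (t k * t k))%N.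
  by rewrite -!big_distrr /= ltn_mul2l.
have -> : (\sum_k 2 * (t k * t k) = \sum_k (t k ^ 2 + m k ^ 2))%N.
  rewrite [RHS]big_split /= (sq m) // -(sq t) // -big_split /=.
  by apply: eq_bigr => i _; rewrite mulnn mul2n -addnn.
rewrite (bigD1 k) //= [X in (_ < X)%N](bigD1 k) //= -addSn.
apply: leq_add; last by apply: leq_sum => i _; rewrite nat_Cauchy.
by rewrite ltn_neqAle !nat_Cauchy andbT eq_sym.
Qed.

Lemma normal_independent R :
  (forall m, m \in msupp R -> exists2 F, is_facet F & normal F m) ->
  (forall u, pairing (R * 'X_[u]) = 0) -> R = 0.
Proof.
move=> nR pR.
suff R0 F m : is_facet F -> normal F m -> R@_m = 0.
  apply/mpolyP => m; rewrite mcoeff0.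
  case: (boolP (m \in msupp R)) => [mR|/memN_msupp_eq0 //].
  by have [F FF nF] := nR m mR; apply: R0 nF.
have [r] := ubnP (facet_rank F); elim: r F m => // r IHr F m.
rewrite ltnS => rF FF.
have [w] := ubnP (weight F m); elim: w m => // w IHw m; rewrite ltnS => wm nF.
(* The complement [u] turns [m] into the top monomial of [F], which occurs in Delta. *)
pose u := (vmnm (top_exp F) - m)%MM.
have mu : (m + u)%MM = vmnm (top_exp F) by rewrite addmC submK // normal_le_top.
have topD := mcoeff_Delta_top FF.
have := pR u; rewrite pairingMX.
(* If [m1 + u] occurs in Delta, its support [G] contains the restriction of [F1] and, through [u],
   the rest of [F] outside its restriction. The two shelling lemmas then give [F1 <= G <= F] in
   rank. *)
have other m1 : m1 \in msupp R -> m1 != m -> R@_m1 * D@_(m1 + u) = 0.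
  move=> m1R m1m; case: (eqVneq (D@_(m1 + u)) 0) => [->|/mcoeff_Delta_neq0 m1P].
    by rewrite mulr0.
  have [F1 FF1 nF1] := nR m1 m1R.
  have [G FG GS] := cells_permute_hook_facet m1P.
  have G1 : F1 = G \/ (facet_rank F1 < facet_rank G)%N.
    apply: restr_sub_facet => // c j /(proj1 nF1) m1j.
    by rewrite -GS mnmDE addn_gt0 m1j.
  have G2 : G = F \/ (facet_rank G < facet_rank F)%N.
    apply: corestr_sub_facet => // c j jF jr; rewrite -GS mnmDE addn_gt0.
    apply/orP; right; rewrite mnmBE vmnmE subn_gt0.
    by have := (proj2 nF) c j; rewrite jF (negbTE jr) addn0 addn1.
  have [eqF|ltF] : F1 = F \/ (facet_rank F1 < facet_rank F)%N.
    by case: G1 G2 => [->|lt1] [<-|lt2];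
      [left | right | right | right; apply: ltn_trans lt2].
  (* On the same facet, [m1 + u] is a monomial of Delta other than the top one, so [weight_lt]
     applies; cancelling [u] shows that [m1] is lighter than [m]. *)
  - rewrite IHw ?mul0r -?eqF //; apply: leq_trans wm; rewrite eqF.
    rewrite -(ltn_add2r (weight F u)) -!weightD mu.
    apply: weight_lt => //; first exact/mcoeff_Delta_neq0.
    by rewrite -mu; apply: contraNneq m1m => /addIm ->.
  by rewrite (IHr F1) ?mul0r // (leq_trans ltF).
case: (boolP (m \in msupp R)) => mR; last by move=> _; rewrite memN_msupp_eq0.
rewrite (bigD1_seq m) ?msupp_uniq //= mu big_seq_cond big1.
  by rewrite addr0 => /eqP; rewrite mulf_eq0 (negbTE topD) orbF => /eqP.
by move=> m1 /andP[m1R m1m]; apply: other.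
Qed.

End HookDelta.

(** * Equality of the two ideals *)

Theorem theorem2 (K L n : nat) (hn : n = (K + L + 1)%N) (P : {mpoly rat[n + n]}) :
  annihilator (Delta n (hook_biexponents K L)) P
  <-> ideal_generated (@hook_generator K L n) P.
Proof.
have genP g : hook_generator K L g -> annihilator (Delta n _) g :=
  @hook_generator_annihilator K L n hn g.
split=> [annP|]; last exact: ideal_generated_annihilator.
(* Both [P] and [P - R] annihilate Delta, hence so does the normal combination [R], which
   independence forces to vanish. *)
have [R [JR nR]] := reducibleT hn P.
suff R0 : R = 0 by rewrite R0 subr0 in JR.
have annPR : annihilator (Delta n (hook_biexponents K L)) (P - R).
  exact: ideal_generated_annihilator JR.
apply: (normal_independent hn nR) => u.
have := pairing_annihilator hn 'X_[u] annPR.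
rewrite mulrBl pairingB (pairing_annihilator hn 'X_[u] annP) sub0r => /eqP.
by rewrite oppr_eq0 => /eqP.
Qed.
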